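(* Let $\alpha\in(0,1/2)$ and $r\in(0,1]$, and write $f=f_\alpha$, $f_k=f_{\alpha,k}$. For every $1\le\ell\le\infty$, the functions $\mathrm{c}_\ell^f$ and $\mathrm{det}_\ell^f$ (of the radius) are continuous at $r$, and $\mathrm{c}_\ell^f(r)=\lim_{k\to\infty}\mathrm{c}_\ell^{f_k}(r)$ and $\mathrm{det}_\ell^f(r)=\lim_{k\to\infty}\mathrm{det}_\ell^{f_k}(r)$.
   Context: For $\alpha\in(0,1/2)$ the continuous map $f_\alpha:[0,1]\to[0,1]$ is defined by: $f_\alpha(x)=x-1+2\alpha^{j-1}-\alpha^j$ for $x\in[1-\alpha^{j-1},1-\alpha^{j-1}+\alpha^j]$, $j\ge1$; $f_\alpha(x)=\frac{1-\alpha+\alpha^2}{2\alpha-1}(x-1)+\alpha^{j+1}\frac{2-\alpha}{2\alpha-1}$ for $x\in(1-\alpha^{j-1}+\alpha^j,1-\alpha^j)$, $j\ge1$; and $f_\alpha(1)=0$. For $k\ge1$, $f_{\alpha,k}:[0,1]\to[0,1]$ is the continuous map equal to $f_\alpha$ on $[0,1-\alpha^{k-1}+\alpha^k]$, equal to $x-1+\alpha^k$ on $[1-\alpha^k,1]$, and linear in between. For a word $u=u_1\dots u_k\in\{0,1\}^k$ put $\kappa(u)=(1-\alpha)\sum_{i=1}^k u_i\alpha^{i-1}$ and $I_\alpha(u)=[\kappa(u),\kappa(u)+\alpha^k]$. The measure $\mu_\alpha$ is the unique Borel probability measure on $[0,1]$ with $\mu_\alpha(I_\alpha(u))=2^{-k}$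 for all $k\ge1$, $u\in\{0,1\}^k$. The measure $\mu_{\alpha,k}$ is the uniform probability measure on the $f_{\alpha,k}$-orbit of $0$ (a periodic orbit with $2^k$ points, namely $\{\kappa(u):u\in\{0,1\}^k\}$). For $g=f_\alpha$ with $\nu=\mu_\alpha$, or $g=f_{\alpha,k}$ with $\nu=\mu_{\alpha,k}$, and $1\le\ell\le\infty$, $r>0$: $\varrho_\ell^g(x,y)=\sup\{|g^i(x)-g^i(y)|:0\le i<\ell\}$, $\mathrm{c}_\ell^g(r)=\nu\times\nu\{(x,y):\varrho_\ell^g(x,y)\le r\}$, $\mathrm{det}_\ell^g(r)=\frac{\ell\,\mathrm{c}_\ell^g(r)-(\ell-1)\mathrm{c}_{\ell+1}^g(r)}{\mathrm{c}_1^g(r)}$ for $\ell<\infty$, and $\mathrm{det}_\infty^g(r)=\mathrm{c}_\infty^g(r)/\mathrm{c}_1^g(r)$. *)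

(* Defs.v *)
From HB Require Import structures.
From mathcomp Require Import all_boot all_order all_algebra.
From mathcomp Require Import all_classical all_reals all_analysis.
From mathcomp Require Import ring lra.

Set Implicit Arguments.
Unset Strict Implicit.
Unset Printing Implicit Defensive.

Import Order.TTheory GRing.Theory Num.Theory.
Import numFieldNormedType.Exports.

Local Open Scope classical_set_scope.
Local Open Scope ring_scope.

(* Maps of [0,1] are represented by total functions R -> R; their values
   outside [0,1] are irrelevant, as are those of falpha_k at k = 0. *)

(* For x in [0,1[, the unique j >= 1 with x in [1-a^(j-1), 1-a^j[; it is this
   union of the two intervals of index j in the definition of f_a. *)
Definition block (R : realType) (a x : R) : nat :=
  xget 1%N [set j | (1 <= j)%N /\ 1 - a ^+ j.-1 <= x < 1 - a ^+ j].

Definition falpha (R : realType) (a x : R) : R :=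
  if x < 1 then
    let j := block a x in
    if x <= 1 - a ^+ j.-1 + a ^+ j then x - 1 + 2 * a ^+ j.-1 - a ^+ j
    else (1 - a + a ^+ 2) / (2 * a - 1) * (x - 1)
         + a ^+ j.+1 * ((2 - a) / (2 * a - 1))
  else 0.

(* On ]p, q[: the chord from (p, f_a p) to (q, q - 1 + a^k). *)
Definition falpha_k (R : realType) (a : R) (k : nat) (x : R) : R :=
  let p := 1 - a ^+ k.-1 + a ^+ k in
  let q := 1 - a ^+ k in
  if x <= p then falpha a x
  else if q <= x then x - 1 + a ^+ k
  else falpha a p + (x - p) / (q - p) * ((q - 1 + a ^+ k) - falpha a p).

Section falpha_facts.
Variables (R : realType) (a : R).
Hypothesis a_gt0_lt2 : 0 < a < 1 / 2.

Let a0 : 0 < a. Proof. by case/andP: a_gt0_lt2. Qed.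
Let a1 : a < 1. Proof. by case/andP: a_gt0_lt2 => _ ?; lra. Qed.

Lemma blockE (x : R) (j : nat) : (1 <= j)%N ->
  1 - a ^+ j.-1 <= x < 1 - a ^+ j -> block a x = j.
Proof.
move=> j1 xj; rewrite /block; case: xgetP => [i _ [i1 xi]|/(_ j)]; last first.
  by case; split.
have aux (m n : nat) : (1 <= n)%N -> 1 - a ^+ m.-1 <= x < 1 - a ^+ m ->
    1 - a ^+ n.-1 <= x < 1 - a ^+ n -> (n <= m)%N.
  move=> n1 /andP[_ xm] /andP[nx _]; rewrite leqNgt; apply/negP => mn.
  have : a ^+ n.-1 <= a ^+ m.
    by rewrite ler_wiXn2l ?(ltW a0) ?(ltW a1)// -ltnS prednK.
  by move: xm nx; lra.
by apply/eqP; rewrite eqn_leq (aux j i)// (aux i j).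
Qed.

Let a_split (j : nat) : (1 <= j)%N -> a ^+ j.-1 - a ^+ j > a ^+ j.
Proof.
case: j => // j _ /=; rewrite exprS; have := exprn_gt0 j a0.
case/andP: a_gt0_lt2 => _ ?; nra.
Qed.

Lemma falphaEl (x : R) (j : nat) : (1 <= j)%N ->
  x \in `[1 - a ^+ j.-1, 1 - a ^+ j.-1 + a ^+ j] ->
  falpha a x = x - 1 + 2 * a ^+ j.-1 - a ^+ j.
Proof.
move=> j1; rewrite in_itv/= => /andP[x1 x2].
have := a_split j1; have := exprn_gt0 j a0 => aj0 aj.
have xj : 1 - a ^+ j.-1 <= x < 1 - a ^+ j by rewrite x1/=; lra.
by rewrite /falpha (blockE j1 xj) x2 ifT//; case/andP: xj; lra.
Qed.

Lemma falphaEr (x : R) (j : nat) : (1 <= j)%N ->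
  x \in `]1 - a ^+ j.-1 + a ^+ j, 1 - a ^+ j[ ->
  falpha a x = (1 - a + a ^+ 2) / (2 * a - 1) * (x - 1)
               + a ^+ j.+1 * ((2 - a) / (2 * a - 1)).
Proof.
move=> j1; rewrite in_itv/= => /andP[x1 x2].
have := exprn_gt0 j a0 => aj0.
have xj : 1 - a ^+ j.-1 <= x < 1 - a ^+ j by rewrite x2 andbT; lra.
by rewrite /falpha (blockE j1 xj) leNgt x1/= ifT//; lra.
Qed.

Lemma falpha1 : falpha a 1 = 0.
Proof. by rewrite /falpha ltxx. Qed.

End falpha_facts.

Definition kappa (R : realType) (a : R) (k : nat) (u : k.-tuple bool) : R :=
  (1 - a) * \sum_(i < k) (tnth u i)%:R * a ^+ i.

Definition Ialpha (R : realType) (a : R) (k : nat) (u : k.-tuple bool) : set R :=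
  `[kappa a u, kappa a u + a ^+ k]%classic.

(* mu is the measure mu_a; Borel probability measures on [0,1] are represented
   by Borel probability measures on R carried by [0,1]. *)
Definition is_mu_alpha (R : realType) (a : R)
    (mu : probability (measurableTypeR R) R) : Prop :=
  mu `[0, 1]%classic = 1%E /\
  forall (k : nat) (u : k.-tuple bool), (1 <= k)%N ->
    mu (Ialpha a u) = ((2 ^+ k)^-1)%:E.

Definition orbit_of (T : Type) (g : T -> T) (x : T) : set T :=
  range (fun n => iter n g x).

Lemma measurable_orbit_of (R : realType) (g : R -> R) (x : R) :
  measurable (orbit_of g x : set (measurableTypeR R)).
Proof.
apply: countable_measurable; first by move=> t; exact: measurable_set1.
exact: (card_le_trans (card_image_le _ _)).
Qed.

(* The normalization of the counting measure on the orbit; the default value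
   dirac x is only used for infinite orbits. *)
Definition orbit_measure (R : realType) (g : R -> R) (x : R) :
    probability (measurableTypeR R) R :=
  mnormalize (mrestr (@counting (measurableTypeR R) R) (measurable_orbit_of g x))
    (dirac (x : measurableTypeR R)).

Definition mu_alpha_k (R : realType) (a : R) (k : nat) :
    probability (measurableTypeR R) R :=
  orbit_measure (falpha_k a k) 0.

(* Lengths l in {0, 1, 2, ..., oo} are of type option nat, None being oo. *)
Definition lt_length (i : nat) (l : option nat) : bool :=
  if l is Some n then (i < n)%N else true.

Definition rho (R : realType) (g : R -> R) (l : option nat) (x y : R) : R :=
  sup [set `|iter i g x - iter i g y| | i in [set i | lt_length i l]].

Definition corr (R : realType) (g : R -> R)
    (nu : probability (measurableTypeR R) R) (l : option nat) (r : R) : R :=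
  fine ((nu \x nu)%E
    [set z | z.1 \in `[0, 1] /\ z.2 \in `[0, 1] /\ rho g l z.1 z.2 <= r]).

Definition determinism (R : realType) (g : R -> R)
    (nu : probability (measurableTypeR R) R) (l : option nat) (r : R) : R :=
  if l is Some n then
    (n%:R * corr g nu (Some n) r - (n%:R - 1) * corr g nu (Some n.+1) r)
    / corr g nu (Some 1%N) r
  else corr g nu None r / corr g nu (Some 1%N) r.

(* Main.v *)
(** The map [falpha a] acts on cylinders as the binary odometer: it sends
    [I(u)] into [I(u + 1)], and [falpha_k a k] does the same on the left
    endpoints [kappa(u)].  Hence on the cylinders of level [k] both systems
    follow the same orbit up to [a^k], and both correlation sums at radius
    [s] are squeezed between frequencies of close pairs of words of length
    [k] at radii [s - 2 a^k] and [s + 2 a^k].  It remains to see that these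
    frequencies cannot jump.  For finite [l] the distance is one of [l]
    distances [|kappa(u + i) - kappa(v + i)|]; for infinite [l],
    subadditivity of [kappa] with respect to addition with carry shows that
    it is [max(kappa(v - u), kappa(u - v))].  In each case, for fixed [u], a
    window shorter than the gaps [(1 - 2a) a^j] meets at most two cylinders
    of level [j], that is a proportion [2 / 2^j] of the words [v]. *)
Require Import Defs.
From mathcomp Require Import all_boot all_order all_algebra.
From mathcomp Require Import all_classical all_reals all_analysis.
From mathcomp Require Import measurable_realfun ring lra zify.

Set Implicit Arguments.
Unset Strict Implicit.
Unset Printing Implicit Defensive.

Import Order.TTheory GRing.Theory Num.Theory.
Import numFieldNormedType.Exports.
Local Open Scope ring_scope.

(* The value [kappa(u)] of the word [u] formed by the first [k] binary digits of [n],
   least significant digit first; it depends only on [n] modulo [2^k], so that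
   [n.+1] is the odometer. *)
Fixpoint kap {R : realType} (a : R) (k n : nat) : R :=
  if k is k'.+1 then (1 - a) * (odd n)%:R + a * kap a k' n./2 else 0.

(** * Digit values: odometer, carries and gaps *)

Section digit_value.
Variables (R : realType) (a : R).

Lemma kap0 (k : nat) : kap a k 0 = 0.
Proof. by elim: k => //= k ->; rewrite !mulr0 addr0. Qed.

Lemma kapD_pow2 (k n q : nat) : kap a k (n + q * 2 ^ k) = kap a k n.
Proof.
elim: k n q => [//|k IHk] n q /=.
have -> : (n + q * 2 ^ k.+1 = n + (q * 2 ^ k).*2)%N.
  by rewrite expnS -mul2n; lia.
by rewrite oddD odd_double addbF halfD odd_double andbF add0n doubleK IHk.
Qed.

Lemma kap_mod (k n : nat) : kap a k (n %% 2 ^ k) = kap a k n.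
Proof. by rewrite [in RHS](divn_eq n (2 ^ k)) addnC kapD_pow2. Qed.

Hypothesis ha : 0 < a < 1 / 2.

Let a0 : 0 < a. Proof. by case/andP: ha. Qed.
Let a2 : a < 1 / 2. Proof. by case/andP: ha. Qed.

Lemma expa_gt0 (k : nat) : 0 < a ^+ k.
Proof. exact: exprn_gt0. Qed.

Lemma expa_le1 (k : nat) : a ^+ k <= 1.
Proof. by apply: exprn_ile1; have := a0; have := a2; lra. Qed.

Lemma kap_ge0 (k n : nat) : 0 <= kap a k n.
Proof.
elim: k n => [//|k IHk] n /=; have := IHk n./2; have := a0; have := a2.
by case: (odd n) => /=; nra.
Qed.

Lemma kap_le (k n : nat) : kap a k n <= 1 - a ^+ k.
Proof.
elim: k n => [|k IHk] n /=; first by rewrite expr0 subrr.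
rewrite exprS; have := IHk n./2; have := a0; have := a2.
by case: (odd n) => /=; nra.
Qed.

(** A carry replaces two digits, worth [1 - a] each, by one digit a place higher, worth at most
    [a * (1 - a)]; since [a < 1], carrying can only lower the value. *)
Lemma kap_subadd (k m n : nat) : kap a k (m + n) <= kap a k m + kap a k n.
Proof.
elim: k m n => [|k IHk] m n /=; first by rewrite addr0.
rewrite oddD halfD.
have h1 : kap a k (1 + (m./2 + n./2)) <= 1 - a + kap a k m./2 + kap a k n./2.
  have le1 : kap a k 1 <= 1 - a.
    case: k {IHk} => [|k] /=; last by rewrite kap0 mulr0 addr0 mulr1.
    by have := a2; lra.
  apply: le_trans (IHk _ _) _; rewrite -addrA; exact: lerD.
have := IHk m./2 n./2; have := a0; have := a2.
by case: (odd m); case: (odd n) h1 => /=; rewrite ?add0n => h1; nra.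
Qed.

(** If the lowest of [k.+1] digits differ, the remaining ones, worth at most [a * (1 - a ^+ k)],
    leave a distance of at least [1 - 2 * a + a ^+ k.+1]. If they agree, a factor [a] cancels and
    the induction goes on with the halves. The term [a ^+ k] is there because left endpoints of
    cylinders of level [k] are compared. *)
Lemma kap_gap (k j m n : nat) : (j <= k)%N ->
  `|kap a k m - kap a k n| < (1 - 2 * a) * a ^+ j + a ^+ k ->
  m = n %[mod 2 ^ j].
Proof.
elim: j k m n => [|j IHj] [|k] m n //; rewrite ?expn0 ?modn1// ltnS => jk.
rewrite /= !exprS => lt_mn.
have := kap_ge0 k m./2; have := kap_ge0 k n./2.
have := kap_le k m./2; have := kap_le k n./2.
have aj : a * a ^+ j <= 1 by rewrite -exprS; exact: expa_le1.
have a1 := a0; have a3 := a2; have ak := expa_gt0 k => un um ln lm.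
have oddE : odd m = odd n.
  by move: lt_mn; case: (odd m) (odd n) => -[]//=; rewrite ltr_norml => /andP[]; nra.
have IH : m./2 = n./2 %[mod 2 ^ j].
  apply: (IHj k) => //; move: lt_mn; rewrite oddE !ltr_norml => /andP[h1 h2].
  by apply/andP; split; nra.
rewrite -[m in LHS](odd_double_half m) -[n in RHS](odd_double_half n) oddE.
by rewrite -[LHS]modnDmr -[RHS]modnDmr expnS -!mul2n -!muln_modr IH.
Qed.
End digit_value.

(** * Counting pairs of words at nearly critical distance *)

Lemma card_prod_set (I J : finType) (B : {set I * J}) (M : nat) :
  (forall i, (#|[set j | (i, j) \in B]| <= M)%N) -> (#|B| <= #|I| * M)%N.
Proof.
move=> BM; rewrite -sum1_card.
rewrite (eq_bigl (fun p => true && ((p.1, p.2) \in B))); last by case.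
rewrite -(pair_big_dep xpredT (fun i j => (i, j) \in B) (fun _ _ => 1%N)) /=.
rewrite -sum_nat_const; apply: leq_sum => i _; apply: leq_trans (BM i).
by rewrite -sum1_card; apply/eq_leq/eq_bigl => j; rewrite inE.
Qed.

(** On [H] the remainder of [h m] modulo [2 ^ j] is constant, so the quotient by [2 ^ j] of the
    residue modulo [2 ^ k] determines that residue, hence [m]; there are [2 ^ (k - j)] such
    quotients. *)
Lemma card_mod_class (k j : nat) (h : 'I_(2 ^ k) -> nat) (H : {set 'I_(2 ^ k)}) :
  (j <= k)%N -> (forall m n, h m = h n %[mod 2 ^ k] -> m = n) ->
  {in H &, forall m n, h m = h n %[mod 2 ^ j]} -> (#|H| <= 2 ^ (k - j))%N.
Proof.
move=> jk hinj Hmod.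
have ltq m : ((h m %% 2 ^ k) %/ 2 ^ j < 2 ^ (k - j))%N.
  by rewrite ltn_divLR ?expn_gt0// -expnD subnK// ltn_mod expn_gt0.
rewrite -[leqRHS]card_ord -(@card_in_imset _ _ (fun m => Ordinal (ltq m)) H).
  exact: max_card.
move=> m n mH nH [] e; apply: hinj.
rewrite (divn_eq (h m %% 2 ^ k) (2 ^ j)) (divn_eq (h n %% 2 ^ k) (2 ^ j)) e.
by rewrite !modn_dvdm ?dvdn_exp2l// (Hmod m n).
Qed.

Section counting_pairs.
Variables (R : realType) (a : R).
Hypothesis ha : 0 < a < 1 / 2.

(** Since the odometer adds one, [m + i] codes the [i]-th iterate of the point coded by [m]; this is
    the discrete form of [rho <= s]. *)
Definition close (k : nat) (l : option nat) (s : R) (m n : nat) : Prop :=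
  forall i, lt_length i l -> `|kap a k (m + i) - kap a k (n + i)| <= s.

Definition close_pairs (k : nat) (l : option nat) (s : R) :
    {set 'I_(2 ^ k) * 'I_(2 ^ k)} :=
  [set p : 'I_(2 ^ k) * 'I_(2 ^ k) | `[< close k l s p.1 p.2 >]].

Lemma in_close_pairs (k : nat) (l : option nat) (s : R) (p : 'I_(2 ^ k) * 'I_(2 ^ k)) :
  reflect (close k l s p.1 p.2) (p \in close_pairs k l s).
Proof. by rewrite inE; exact: asboolP. Qed.

(** For a fixed first coordinate, the sign of [c - kap] splits the window into two intervals shorter
    than the gap, and by [kap_gap] each contains values of a single class modulo [2 ^ j]. The map
    [h] is a translation for finite lengths, a difference modulo [2 ^ k] for the infinite one. *)
Lemma card_window (k j : nat) (s t : R) (c : 'I_(2 ^ k) -> R)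
    (h : 'I_(2 ^ k) -> 'I_(2 ^ k) -> nat) :
  (j <= k)%N -> t - s < (1 - 2 * a) * a ^+ j ->
  (forall i m n, h i m = h i n %[mod 2 ^ k] -> m = n) ->
  (#|[set p : 'I_(2 ^ k) * 'I_(2 ^ k) |
      (s < `|c p.1 - kap a k (h p.1 p.2)| <= t)%R]|
     <= 2 ^ k * (2 * 2 ^ (k - j)))%N.
Proof.
move=> jk st hinj; rewrite -[X in (_ <= X * _)%N]card_ord.
apply: card_prod_set => i.
pose S := [set m | s < `|c i - kap a k (h i m)| <= t].
rewrite (_ : [set m | _] = S); last by apply/setP => m; rewrite !inE.
pose b m := kap a k (h i m) <= c i.
have -> : S = [set m in S | b m] :|: [set m in S | ~~ b m].
  by apply/setP => m; rewrite !inE -andb_orr orbN andbT.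
apply: leq_trans (leq_card_setU _ _) _; rewrite mul2n -addnn.
have ak := expa_gt0 ha k.
apply: leq_add; apply: (card_mod_class jk (hinj i)) => m n;
  rewrite !inE /b -?ltNge => /andP[/andP[m1 m2] m3] /andP[/andP[n1 n2] n3];
  move: m1 m2 n1 n2.
  rewrite !ger0_norm ?subr_ge0// => m1 m2 n1 n2; apply: (kap_gap ha jk).
  by rewrite ltr_norml; apply/andP; split; lra.
rewrite !ltr0_norm ?subr_lt0// => m1 m2 n1 n2; apply: (kap_gap ha jk).
by rewrite ltr_norml; apply/andP; split; lra.
Qed.

(** A pair that is close at radius [t] but not at [s] has one of finitely many distances in []s,
    t]]; [L] is the number of these distances, which does not grow with [k]. *)
Lemma card_close_pairs (l : option nat) : exists L : nat,
  forall (k j : nat) (s t : R), (j <= k)%N -> t - s < (1 - 2 * a) * a ^+ j ->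
  (#|close_pairs k l t| <=
    #|close_pairs k l s| + L * (2 ^ k * (2 * 2 ^ (k - j))))%N.
Proof.
have modinj k (d : nat) (m n : 'I_(2 ^ k)) :
    (m + d = n + d %[mod 2 ^ k])%N -> m = n.
  by move/eqP; rewrite eqn_modDr !modn_small// => /eqP/val_inj.
case: l => [l|].
  exists l => k j s t jk st.
  pose W i := [set p : 'I_(2 ^ k) * 'I_(2 ^ k) |
    s < `|kap a k (p.1 + i) - kap a k (p.2 + i)| <= t].
  have Wcard i : (#|W i| <= 2 ^ k * (2 * 2 ^ (k - j)))%N.
    apply: (card_window (fun n : 'I_(2 ^ k) => kap a k (n + i))
      (h := fun _ m => (m + i)%N)) => // _; exact: modinj.
  rewrite -[l in (l * _)%N]card_ord -sum_nat_const.
  apply: (@leq_trans (#|close_pairs k (Some l) s :|: \bigcup_(i < l) W i|)).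
    apply/subset_leq_card/fintype.subsetP => p /in_close_pairs pt.
    rewrite finset.in_setU.
    case: in_close_pairs => //= /existsNP[i /not_implyP[il /negP]].
    rewrite -ltNge => si; apply/bigcupP; exists (Ordinal il) => //.
    by rewrite inE si; exact: pt.
  apply: leq_trans (leq_card_setU _ _) _; rewrite leq_add2l.
  apply: (big_ind2 (fun (A : {set 'I_(2 ^ k) * 'I_(2 ^ k)}) M => #|A| <= M)%N).
  - by rewrite cards0.
  - move=> A M B N AM BN; apply: leq_trans (leq_card_setU _ _) _.
    exact: leq_add.
  - by move=> i _; exact: Wcard.
exists 2%N => k j s t jk st.
pose W1 := [set p : 'I_(2 ^ k) * 'I_(2 ^ k) |
    s < `|0 - kap a k (p.2 + (2 ^ k - p.1))| <= t].
pose W2 := [set p : 'I_(2 ^ k) * 'I_(2 ^ k) |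
    s < `|0 - kap a k (p.1 + (2 ^ k - p.2))| <= t].
have W1card : (#|W1| <= 2 ^ k * (2 * 2 ^ (k - j)))%N.
  apply: (card_window (fun=> 0) (h := fun n m => (m + (2 ^ k - n))%N)) => // i.
  exact: modinj.
have W2card : (#|W2| <= 2 ^ k * (2 * 2 ^ (k - j)))%N.
  apply: (card_window (fun=> 0) (h := fun n m => (n + (2 ^ k - m))%N)) => // i m n e.
  (* Added to [m] or to [n], this shift gives [i + 2 ^ k] modulo [2 ^ k], by [e] in the case of
     [n]. *)
  apply: (modinj k (i + (2 ^ k - m))%N).
  rewrite -[in RHS]modnDmr e modnDmr [in RHS]addnCA [in LHS]addnCA subnKC 1?ltnW//.
  by rewrite subnKC 1?ltnW.
apply: (@leq_trans (#|close_pairs k None s :|: (W1 :|: W2)|)).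
  apply/subset_leq_card/fintype.subsetP => -[m n] /in_close_pairs /= mnt.
  rewrite !finset.in_setU.
  case: in_close_pairs => //= /existsNP[i /not_implyP[_ /negP]].
  rewrite -ltNge !finset.in_set /= => si.
  have kapP (p : 'I_(2 ^ k)) : kap a k (p + (2 ^ k - p)) = 0.
    by rewrite subnKC 1?ltnW// -(kap0 a k) -[RHS](kapD_pow2 a k 0 1) mul1n.
  (* the number [n + (2^k - m)] represents [n - m] modulo [2^k] *)
  have shift (p q : 'I_(2 ^ k)) :
      kap a k (p + i) <= kap a k (q + i) + kap a k (p + (2 ^ k - q)).
    apply: le_trans (kap_subadd ha _ _ _).
    have -> : (q + i + (p + (2 ^ k - q)) = p + i + 1 * 2 ^ k)%N.
      by have := ltn_ord q; lia.
    by rewrite kapD_pow2.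
  (* At these two times one of the orbits is at [0], which yields the upper bounds [t] of both
     windows. *)
  have m1 := mnt (2 ^ k - m)%N isT; have m2 := mnt (2 ^ k - n)%N isT.
  move: m1 m2; rewrite !kapP subr0 !sub0r !normrN => -> ->.
  rewrite !andbT !ger0_norm ?kap_ge0//.
  have := shift m n; have := shift n m.
  (* The sign of the difference at time [i] decides which instance of [shift] carries the lower
     bound [s] over to [W1] or [W2]. *)
  move: si; rewrite lter_normr => /orP[] *; apply/orP; [right|left]; lra.
apply: leq_trans (leq_card_setU _ _) _; rewrite leq_add2l.
apply: leq_trans (leq_card_setU _ _) _.
by rewrite mul2n -addnn leq_add.
Qed.

End counting_pairs.

Local Open Scope classical_set_scope.
Local Open Scope ring_scope.

(** * The two maps on cylinders and their endpoints *)

Section maps.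
Variables (R : realType) (a : R).
Hypothesis ha : 0 < a < 1 / 2.

Let a0 : 0 < a. Proof. by case/andP: ha. Qed.
Let a2 : a < 1 / 2. Proof. by case/andP: ha. Qed.

Lemma kappa_kap (k n : nat) :
  kappa a [tuple odd (iter i half n) | i < k] = kap a k n.
Proof.
rewrite /kappa; under eq_bigr do rewrite tnth_mktuple.
elim: k n => [|k IHk] n; first by rewrite big_ord0 mulr0.
rewrite big_ord_recl /= expr0 mulr1 mulrDr -IHk; congr (_ + _).
rewrite [RHS]mulrCA; congr (_ * _); rewrite mulr_sumr; apply: eq_bigr => i _.
by rewrite /bump /= add1n -iterS iterSr exprS mulrCA.
Qed.

Lemma expa_near (d : R) : 0 < d -> \forall k \near \oo, a ^+ k < d.
Proof.
move=> d0; have /cvgrPdist_lt/(_ d d0) : (fun n => a ^+ n) @ \oo --> (0 : R).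
  by apply: cvg_expr; rewrite ger0_norm; have := a0; have := a2; lra.
apply: filterS => k; rewrite sub0r normrN; exact: le_lt_trans (ler_norm _).
Qed.

Lemma exists_block (x : R) : 0 <= x < 1 ->
  exists j, 1 - a ^+ j <= x < 1 - a ^+ j.+1.
Proof.
move=> /andP[x0 x1].
have [n nx] : exists n, x < 1 - a ^+ n.
  have x1' : 0 < 1 - x by lra.
  have [n _ /(_ n (leqnn n)) /= nx] := expa_near x1'.
  by exists n; lra.
have ex : exists n, (x < 1 - a ^+ n)%R by exists n.
case: (ex_minnP ex) => -[|m] mx mmin; first by move: mx x0; rewrite expr0; lra.
exists m; rewrite mx andbT leNgt; apply/negP => /mmin; by rewrite ltnn.
Qed.

Lemma falpha_left (x : R) : 0 <= x <= a -> falpha a x = x + (1 - a).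
Proof.
move=> xa; rewrite (@falphaEl _ _ ha x 1)// ?in_itv/= ?expr0 ?expr1; first lra.
by case/andP: xa => *; apply/andP; split; lra.
Qed.

(** Self-similarity: [1 - a + a * y] carries each block to the next one and preserves its two
    branches. This is the carry of the odometer. *)
Lemma falpha_right (y : R) : 0 <= y <= 1 ->
  falpha a (1 - a + a * y) = a * falpha a y.
Proof.
move=> /andP[y0 y1]; have b0 := a0; have b2 := a2.
have [->|yn1] := eqVneq y 1.
  by rewrite mulr1 (_ : 1 - a + a = 1) ?falpha1 ?mulr0//; lra.
have /exists_block[j /andP[yj1 yj2]] : 0 <= y < 1 by rewrite y0 lt_neqAle yn1.
have a2n : 2 * a - 1 != 0 by rewrite lt_eqF//; lra.
have [yl|yr] := leP y (1 - a ^+ j + a ^+ j.+1).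
  rewrite (@falphaEl _ _ ha y j.+1) ?in_itv/= ?yj1//.
  rewrite (@falphaEl _ _ ha _ j.+2) ?in_itv/=//; rewrite !exprS in yl yj2 *.
    by ring.
  by apply/andP; split; nra.
rewrite (@falphaEr _ _ ha y j.+1) ?in_itv/= ?yr//.
rewrite (@falphaEr _ _ ha _ j.+2) ?in_itv/=//; rewrite !exprS in yr yj2 *.
  by field.
by apply/andP; split; nra.
Qed.

(** The first block is estimated directly; [falpha_right] transports the bounds to the later
    blocks. *)
Lemma falpha_itv (x : R) : 0 <= x <= 1 -> 0 <= falpha a x <= 1.
Proof.
move=> /andP[x0 x1]; have b0 := a0; have b2 := a2.
have base y : 0 <= y < 1 - a -> 0 <= falpha a y <= 1.
  move=> /andP[y0 y1]; have [ya|ya] := leP y a.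
    by rewrite falpha_left ?y0//; lra.
  rewrite (@falphaEr _ _ ha y 1) ?in_itv/= ?expr0 ?expr1 ?subrr ?add0r ?ya//.
  have c0 : 0 < 1 - 2 * a by lra.
  have -> : (1 - a + a ^+ 2) / (2 * a - 1) * (y - 1) +
      a ^+ 2 * ((2 - a) / (2 * a - 1)) =
      ((1 - a + a ^+ 2) * (1 - y) - a ^+ 2 * (2 - a)) / (1 - 2 * a).
    have c1 : 1 - 2 * a != 0 by rewrite gt_eqF.
    have c2 : 2 * a - 1 != 0 by rewrite lt_eqF//; lra.
    by field; rewrite c1 c2.
  rewrite ler_pdivrMr// ler_pdivlMr// mul0r mul1r.
  (* The numerator decreases in [y] from [1 - 2 * a] at [y = a] to [a * (1 - a) * (1 - 2 * a)] at
     [y = 1 - a]. *)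
  have c3 : 0 < 1 - a + a ^+ 2 by nra.
  have c4 : 0 <= a * (1 - a) * (1 - 2 * a) by rewrite !mulr_ge0//; lra.
  have c5 : 0 <= (1 - a + a ^+ 2) * (1 - a - y) by rewrite mulr_ge0//; lra.
  have c6 : 0 <= (1 - a + a ^+ 2) * (y - a) by rewrite mulr_ge0//; lra.
  by apply/andP; split; nra.
have [->|xn1] := eqVneq x 1; first by rewrite falpha1; lra.
have /exists_block[j /andP[_]] : 0 <= x < 1 by rewrite x0 lt_neqAle xn1.
elim: j x x0 x1 {xn1} => [|j IHj] x x0 x1 xj; first by rewrite base ?x0.
have [xa|xa] := ltP x (1 - a); first by rewrite base ?x0.
have [y xy] : exists y, x = 1 - a + a * y.
  by exists ((x - (1 - a)) / a); field; rewrite gt_eqF.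
have y01 : 0 <= y <= 1 by rewrite {}xy in xa x1; apply/andP; split; nra.
rewrite xy falpha_right//; case/andP: (y01) => y0 y1.
have /(IHj y y0 y1) : y < 1 - a ^+ j.+1.
  by move: xj; rewrite xy exprS; nra.
by move=> /andP[f0 f1]; apply/andP; split; nra.
Qed.

(** A lowest digit [0] becomes [1] by the translation [falpha_left]; a lowest digit [1] becomes [0]
    and [falpha_right] passes the carry to the remaining digits. *)
Lemma falpha_cylinder (k n : nat) (x : R) :
  kap a k n <= x <= kap a k n + a ^+ k ->
  kap a k n.+1 <= falpha a x <= kap a k n.+1 + a ^+ k.
Proof.
have b0 := a0; have b2 := a2.
elim: k n x => [|k IHk] n x /=; first by rewrite expr0 add0r; exact: falpha_itv.
rewrite exprS => xI; rewrite uphalf_half.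
have [y xy] : exists y, x = (1 - a) * (odd n)%:R + a * y.
  by exists ((x - (1 - a) * (odd n)%:R) / a); field; rewrite gt_eqF.
have yI : kap a k n./2 <= y <= kap a k n./2 + a ^+ k.
  by move: xI; rewrite xy => /andP[? ?]; apply/andP; split; nra.
have := kap_ge0 ha k n./2; have := kap_le ha k n./2 => k1 k0.
case/andP: (yI) => y1 y2.
rewrite xy; case: (odd n) => /=; rewrite ?(mulr0, mulr1) ?(addn0, add0r, add1n, add0n).
  rewrite falpha_right; last by apply/andP; split; lra.
  by case/andP: (IHk _ _ yI) => ? ?; apply/andP; split; nra.
by rewrite falpha_left; apply/andP; split; nra.
Qed.

Lemma falpha_k_left (k : nat) (x : R) : 0 <= x <= a ->
  falpha_k a k.+1 x = x + (1 - a).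
Proof.
move=> xa; rewrite /falpha_k ifT ?falpha_left//=.
have := a0; have := a2; have := expa_le1 ha k; rewrite exprS.
by case/andP: xa => *; nra.
Qed.

(** The rescaling also takes the break points [p] and [q] of level [k.+1] to those of level [k.+2],
    so that all three branches correspond. *)
Lemma falpha_k_right (k : nat) (y : R) : 0 <= y <= 1 ->
  falpha_k a k.+2 (1 - a + a * y) = a * falpha_k a k.+1 y.
Proof.
move=> y01; have b0 := a0; have b2 := a2.
have := expa_gt0 ha k; have := expa_le1 ha k.
rewrite /falpha_k /= !exprS; set b := a ^+ k => b1 bgt0.
have -> : (1 - a + a * y <= 1 - a * b + a * (a * b)) = (y <= 1 - b + a * b).
  by apply/idP/idP => ?; nra.
have -> : (1 - a * (a * b) <= 1 - a + a * y) = (1 - a * b <= y).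
  by apply/idP/idP => ?; nra.
have -> : 1 - a * b + a * (a * b) = 1 - a + a * (1 - b + a * b) by ring.
rewrite !falpha_right//; last by apply/andP; split; nra.
case: ifP => // _; case: ifP => _; first by ring.
have h : 1 - a * b - (1 - b + a * b) != 0 by rewrite gt_eqF//; nra.
have h' : 1 - a * (a * b) - (1 - a + a * (1 - b + a * b)) != 0.
  by rewrite gt_eqF//; nra.
by field; rewrite h.
Qed.

(** The carry argument of [falpha_cylinder], now exact; it ends at level one, where the map
    exchanges [0] and [1 - a]. *)
Lemma falpha_k_kap (k n : nat) :
  falpha_k a k.+1 (kap a k.+1 n) = kap a k.+1 n.+1.
Proof.
have b0 := a0; have b2 := a2.
elim: k n => [|k IHk] n.
  rewrite /= !mulr0 !addr0 /falpha_k /= expr0 expr1; case: (odd n) => /=.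
    by rewrite mulr1 mulr0 ifF ?ifT//; [ring | apply/negbTE; rewrite -ltNge; lra].
  rewrite mulr0 mulr1 ifT; last lra.
  by rewrite falpha_left ?add0r// lexx ltW.
have kapE m : kap a k.+2 m = (1 - a) * (odd m)%:R + a * kap a k.+1 m./2 by [].
have := kap_ge0 ha k.+1 n./2; have := kap_le ha k.+1 n./2.
have := expa_gt0 ha k.+1; rewrite !kapE oddS [n.+1./2]uphalf_half.
move: (kap a k.+1) IHk => g IHk ak k1 k0; case: (odd n) => /=.
  rewrite mulr1 mulr0 add0r falpha_k_right ?IHk//.
  by apply/andP; split; lra.
rewrite mulr1 mulr0 !add0r add0n falpha_k_left 1?addrC//.
by apply/andP; split; nra.
Qed.

Lemma falpha_k_itv (k : nat) (x : R) : 0 <= x <= 1 ->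
  0 <= falpha_k a k.+1 x <= 1.
Proof.
move=> /andP[x0 x1]; have b0 := a0; have b2 := a2.
have := expa_gt0 ha k; have := expa_le1 ha k.
rewrite /falpha_k /= !exprS; set b := a ^+ k => b1 bgt0.
case: ifP => [_|/negbT]; first by apply: falpha_itv; rewrite x0.
rewrite -ltNge => px; case: ifP => [qx|/negbT].
  by apply/andP; split; nra.
rewrite -ltNge => xq.
have /falpha_itv/andP[] : 0 <= 1 - b + a * b <= 1 by apply/andP; split; nra.
(* As [q - 1 + a ^+ k] vanishes at the right end of the chord, the value in question is
   [(1 - t) * y]. *)
set y := falpha a _ => y0 y1; set t := _ / _.
have t0 : 0 <= t by rewrite divr_ge0//; lra.
have t1 : t <= 1 by rewrite ler_pdivrMr; lra.
by apply/andP; split; nra.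
Qed.

End maps.

(** * Measurability of the maps *)

Section measurability.
Variables (R : realType) (a : R).
Hypothesis ha : 0 < a < 1 / 2.

Let a0 : 0 < a. Proof. by case/andP: ha. Qed.
Let a2 : a < 1 / 2. Proof. by case/andP: ha. Qed.

Lemma measurable_falpha :
  measurable_fun setT (falpha a : measurableTypeR R -> measurableTypeR R).
Proof.
(* The sets [B n.+1] are the blocks of [[0, 1[] and [B 0] is the rest of the line; [falpha] has an
   explicit formula on each piece. *)
pose B (n : nat) : set (measurableTypeR R) := if n is n'.+1 then
  `[1 - a ^+ n', 1 - a ^+ n'.+1[%classic else `]-oo, 0[ `|` `[1, +oo[.
have mB n : measurable (B n).
  by case: n => [|n] /=; [apply: measurableU|]; exact: measurable_itv.
have -> : setT = \bigcup_n B n.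
  apply/seteqP; split => // x _.
  have [x0|x0] := ltP x 0.
    by exists 0%N => //; left; rewrite /= in_itv.
  have [x1|x1] := ltP x 1; last by exists 0%N => //; right; rewrite /= in_itv/= x1.
  have [|j xj] := @exists_block _ _ ha x; first by rewrite x0.
  by exists j.+1 => //=; rewrite in_itv.
apply/(measurable_fun_bigcup _ mB) => -[|n] /=.
  apply/measurable_funU => //; split.
    apply: (@eq_measurable_fun _ _ _ _ _ (fun x : R => x + (1 - a))).
      move=> x; rewrite inE/= in_itv/= => x0.
      (* No block contains a negative [x], so [block] takes its default value [1] and the left
         branch applies. *)
      rewrite /falpha /block xgetPN; last first.
        move=> j /= [_ /andP[jx _]]; have := expa_le1 ha j.-1; lra.
      by rewrite expr0 expr1 !ifT; have := a0; lra.
    by apply: measurable_funTS; apply: measurable_funD.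
  apply: (@eq_measurable_fun _ _ _ _ _ (cst (0 : R))).
    move=> x; rewrite inE/= in_itv/= andbT => x1.
    by rewrite /falpha ltNge x1.
  exact: measurable_cst.
pose g (x : R) := if x <= 1 - a ^+ n + a ^+ n.+1
  then x - 1 + 2 * a ^+ n - a ^+ n.+1
  else (1 - a + a ^+ 2) / (2 * a - 1) * (x - 1)
    + a ^+ n.+2 * ((2 - a) / (2 * a - 1)).
apply: (@eq_measurable_fun _ _ _ _ _ g).
  move=> x; rewrite inE/= in_itv/= => xn.
  rewrite /falpha (@blockE _ _ ha x n.+1)// ifT//.
  case/andP: xn => _ xn; apply: lt_trans xn _.
  by have := expa_gt0 ha n.+1; lra.
apply: measurable_funTS; apply: measurable_fun_ifT.
- exact: measurable_fun_ler.
- by do !apply: measurable_funD.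
- apply: measurable_funD => //; apply: measurable_funM => //.
  exact: measurable_funD.
Qed.

Lemma measurable_falpha_k (k : nat) :
  measurable_fun setT
    (falpha_k a k : measurableTypeR R -> measurableTypeR R).
Proof.
apply: measurable_fun_ifT; first exact: measurable_fun_ler.
  exact: measurable_falpha.
apply: measurable_fun_ifT; first exact: measurable_fun_ler.
  by do !apply: measurable_funD.
apply: measurable_funD => //; apply: measurable_funM => //.
by apply: measurable_funM => //; apply: measurable_funD.
Qed.
End measurability.

(** * Correlation sums between frequencies of close pairs *)

Lemma card_le_measure d (T : measurableType d) (R : realType)
    (P : probability T R) (I : finType) (F : I -> set T) (w : R)
    (A : {set I}) (U : set T) :
  (forall i, measurable (F i)) -> trivIset setT F -> (forall i, P (F i) = w%:E) ->
  measurable U -> (forall i, i \in A -> F i `<=` U) ->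
  ((#|A|%:R * w)%:E <= P U)%E.
Proof.
move=> mF tF PF mU AU.
have tF' : trivIset [set` enum A] F by exact: sub_trivIset tF.
apply: (@le_trans _ _ (P (\bigcup_(i in [set` enum A]) F i))).
  rewrite measure_fin_bigcup// -fsbig_seq ?enum_uniq//.
  rewrite (eq_bigr (fun=> w%:E)) => [|i _]; last exact: PF.
  by rewrite sumEFin big_enum/= sumr_const mulr_natl lexx.
apply: le_measure; rewrite ?inE//.
  exact: fin_bigcup_measurable.
by apply: bigcup_sub => i /=; rewrite mem_enum => /AU.
Qed.

Section approximation.
Variables (R : realType) (g : R -> R) (l : option nat).
Hypotheses (mg : measurable_fun setT
              (g : measurableTypeR R -> measurableTypeR R))
  (g01 : forall x, 0 <= x <= 1 -> 0 <= g x <= 1) (hl : lt_length 0 l).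

Lemma rho_leP (x y s : R) : 0 <= x <= 1 -> 0 <= y <= 1 ->
  rho g l x y <= s <->
  (forall i, lt_length i l -> `|iter i g x - iter i g y| <= s).
Proof.
move=> x01 y01; have iter01 i z : 0 <= z <= 1 -> 0 <= iter i g z <= 1.
  by move=> z01; elim: i => //= i; exact: g01.
split=> [rs i il|le_s].
  apply: le_trans rs; apply: sup_upper_bound; last by exists i.
  split; first by exists `|iter i g x - iter i g y|, i.
  exists 1 => _ [j _ <-].
  have := iter01 j x x01; have := iter01 j y y01.
  by rewrite ler_norml => /andP[? ?] /andP[? ?]; apply/andP; split; lra.
apply: ge_sup; last by move=> _ [i il <-]; exact: le_s.
by exists `|iter 0 g x - iter 0 g y|, 0%N.
Qed.

Lemma measurable_iter (i : nat) :
  measurable_fun setT (iter i g : measurableTypeR R -> measurableTypeR R).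
Proof. by elim: i => [|i IHi]; [exact: measurable_id|exact: measurableT_comp]. Qed.

Definition close_set (s : R) : set (measurableTypeR R * measurableTypeR R) :=
  [set z | z.1 \in `[0, 1] /\ z.2 \in `[0, 1] /\ rho g l z.1 z.2 <= s].

Lemma measurable_close_set (s : R) : measurable (close_set s).
Proof.
have -> : close_set s = (`[0, 1] `*` `[0, 1]) `&`
    \bigcap_(i in [set i | lt_length i l])
      [set z | `|iter i g z.1 - iter i g z.2| <= s].
  apply/seteqP; split => -[x y] /=; rewrite /close_set /= !in_itv/=.
    by move=> [x01 [y01 /rho_leP H]]; split => // i /= il; exact: H.
  by move=> [[x01 y01] H]; do 2!split => //; apply/rho_leP => // i /H.
apply: measurableI; first by apply: measurableX; exact: measurable_itv.
apply: bigcap_measurable => [|i _]; first by exists 0%N.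
rewrite -[X in measurable X]setTI.
apply: (@measurable_fun_ler _ _ _ setT
  (fun z => `|iter i g z.1 - iter i g z.2|) (cst s)) => //.
apply: measurableT_comp; first exact: normr_measurable.
by apply: measurable_funB; apply: measurableT_comp (measurable_iter i) _.
Qed.

End approximation.

Definition close_freq (R : realType) (a : R) (k : nat) (l : option nat) (s : R) : R :=
  #|close_pairs a k l s|%:R * ((2 ^+ k)^-1 * (2 ^+ k)^-1).

Lemma mnormalizeE d (T : measurableType d) (R : realType) (m : measure T R)
    (P : probability T R) (w : R) (U : set T) :
  0 < w -> m setT = w%:E -> mnormalize m P U = (m U * (w^-1)%:E)%E.
Proof. by move=> w0 mT; rewrite /mnormalize mT eqe gt_eqF. Qed.

(* The sets [E n] code the system [(g, nu)] by the odometer modulo [2^k] up to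
   the error [e]. *)
Section coding.
Variables (R : realType) (a : R) (g : R -> R) (nu : probability (measurableTypeR R) R).
Variables (l : option nat) (k : nat) (e : R).
Variable E : 'I_(2 ^ k) -> set (measurableTypeR R).
Hypotheses (mg : measurable_fun setT
              (g : measurableTypeR R -> measurableTypeR R))
  (g01 : forall x, 0 <= x <= 1 -> 0 <= g x <= 1) (hl : lt_length 0 l).
Hypotheses (mE : forall n, measurable (E n)) (tE : trivIset setT E)
  (nuE : forall n, nu (E n) = ((2 ^+ k)^-1)%:E)
  (E01 : forall n x, E n x -> 0 <= x <= 1)
  (Ekap : forall n x i, E n x -> `|iter i g x - kap a k (n + i)| <= e).

Let F (p : 'I_(2 ^ k) * 'I_(2 ^ k)) := E p.1 `*` E p.2.

Let mF p : measurable (F p).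
Proof. exact: measurableX. Qed.

Let tF : trivIset setT F.
Proof.
apply/trivIsetP => -[m n] [m' n'] _ _ mn; apply/seteqP; split => // -[x y].
move=> [[/= mx ny] [/= mx' ny']]; case/eqP: mn; congr (_, _).
  by apply: tE => //; exists x.
by apply: tE => //; exists y.
Qed.

Let nuF p : (nu \x nu)%E (F p) = ((2 ^+ k)^-1 * (2 ^+ k)^-1)%:E.
Proof.
transitivity (nu (E p.1) * nu (E p.2))%E; first exact: product_measure1E.
by rewrite !nuE EFinM.
Qed.

Let iter_close (m n : 'I_(2 ^ k)) (x y : R) (i : nat) : E m x -> E n y ->
  `|(iter i g x - iter i g y) - (kap a k (m + i) - kap a k (n + i))| <= 2 * e.
Proof.
move=> /(@Ekap _ _ i) + /(@Ekap _ _ i).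
rewrite !ler_norml => /andP[? ?] /andP[? ?].
by apply/andP; split; lra.
Qed.

Let corrE (s : R) : (nu \x nu)%E (close_set g l s) = (corr g nu l s)%:E.
Proof.
pose P : probability _ R := (nu \x nu)%E.
by have /fineK <- := fin_num_measure P _ (measurable_close_set mg g01 hl s).
Qed.

(** The margin [2 * e] pays for the coding error of both points, so the rectangles over close pairs
    lie in [close_set]. *)
Lemma close_freq_le_corr (s : R) :
  close_freq a k l (s - 2 * e) <= corr g nu l s.
Proof.
have mS := measurable_close_set mg g01 hl s.
rewrite -lee_fin -corrE.
apply: (card_le_measure mF tF nuF mS) => -[m n] /in_close_pairs /= mn [x y] [/= mx ny].
split; first by rewrite in_itv/=; exact: E01 mx.
split; first by rewrite in_itv/=; exact: E01 ny.
apply/(rho_leP g01 hl s (E01 mx) (E01 ny)) => i il.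
have := mn i il; have := iter_close i mx ny; rewrite !ler_norml.
by move=> /andP[? ?] /andP[? ?]; apply/andP; split; lra.
Qed.

(** The same count in the complement: rectangles over pairs that are not close miss [close_set]. All
    rectangles together have mass one, so subtraction gives the upper bound. *)
Lemma corr_le_close_freq (s : R) :
  corr g nu l s <= close_freq a k l (s + 2 * e).
Proof.
have mS := measurable_close_set mg g01 hl s.
have : ((#|~: close_pairs a k l (s + 2 * e)|%:R *
    ((2 ^+ k)^-1 * (2 ^+ k)^-1))%:E <= (nu \x nu) (~` close_set g l s))%E.
  apply: (card_le_measure mF tF nuF); first exact: measurableC.
  move=> -[m n]; rewrite finset.in_setC => /in_close_pairs /= mn [x y] [/= mx ny].
  move=> [_ [_ /(rho_leP g01 hl _ (E01 mx) (E01 ny)) H]]; apply: mn => i il.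
  have := H i il; have := iter_close i mx ny; rewrite !ler_norml.
  by move=> /andP[? ?] /andP[? ?]; apply/andP; split; lra.
have -> : (nu \x nu)%E (~` close_set g l s) = (1 - (corr g nu l s)%:E)%E.
  by rewrite -corrE; exact: (probability_setC ((nu \x nu)%E : probability _ R) mS).
rewrite -EFinB lee_fin.
have -> : #|~: close_pairs a k l (s + 2 * e)|%:R =
    2 ^+ k * 2 ^+ k - #|close_pairs a k l (s + 2 * e)|%:R :> R.
  have := cardsC (close_pairs a k l (s + 2 * e)).
  rewrite card_prod !card_ord => /(congr1 (fun n => n%:R : R)).
  by rewrite natrD natrM natrX => <-; ring.
rewrite mulrBl -/(close_freq a k l (s + 2 * e)).
have -> : 2 ^+ k * 2 ^+ k * ((2 ^+ k)^-1 * (2 ^+ k)^-1) = 1 :> R.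
  by field; rewrite expf_neq0.
lra.
Qed.

End coding.

(** * Coding by cylinders and by orbit points *)

Section codings.
Variables (R : realType) (a : R) (l : option nat).
Hypotheses (ha : 0 < a < 1 / 2) (hl : lt_length 0 l).

Let a0 : 0 < a. Proof. by case/andP: ha. Qed.
Let a2 : a < 1 / 2. Proof. by case/andP: ha. Qed.

(** The case [j = k] of [kap_gap]; it makes the cylinders of level [k] disjoint and the orbit points
    distinct. *)
Lemma kap_inj (k : nat) (m n : 'I_(2 ^ k)) :
  `|kap a k m - kap a k n| <= a ^+ k -> m = n.
Proof.
move=> mn; apply/val_inj.
have : (m = n %[mod 2 ^ k])%N.
  apply: (kap_gap ha (leqnn k)); apply: le_lt_trans mn _.
  by rewrite ltrDr mulr_gt0 ?expa_gt0//; have := a2; lra.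
by rewrite !modn_small.
Qed.

Lemma corr_falpha_bounds (mu : probability (measurableTypeR R) R) (k : nat) (s : R) :
  is_mu_alpha a mu -> (0 < k)%N ->
  close_freq a k l (s - 2 * a ^+ k) <= corr (falpha a) mu l s
    <= close_freq a k l (s + 2 * a ^+ k).
Proof.
move=> [_ muI] k0.
pose E (n : 'I_(2 ^ k)) : set (measurableTypeR R) :=
  Ialpha a [tuple odd (iter i half n) | i < k].
have EP n x : E n x -> kap a k n <= x <= kap a k n + a ^+ k.
  by rewrite /E /Ialpha /= in_itv/= kappa_kap.
have mE n : measurable (E n) by exact: measurable_itv.
have nuE n : mu (E n) = ((2 ^+ k)^-1)%:E by exact: muI.
have tE : trivIset setT E.
  move=> m n _ _ [x [/EP/andP[? ?] /EP/andP[? ?]]]; apply: kap_inj => //.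
  by rewrite ler_norml; apply/andP; split; lra.
have E01 n x : E n x -> 0 <= x <= 1.
  move=> /EP/andP[? ?]; have := kap_ge0 ha k n; have := kap_le ha k n.
  by move=> *; apply/andP; split; lra.
have Ekap n x i : E n x -> `|iter i (falpha a) x - kap a k (n + i)| <= a ^+ k.
  move=> /EP nx.
  have : kap a k (n + i) <= iter i (falpha a) x <= kap a k (n + i) + a ^+ k.
    by elim: i => [|i IHi]; rewrite ?addn0// addnS; exact: falpha_cylinder.
  by have := expa_gt0 ha k => ? /andP[? ?]; rewrite ler_norml; apply/andP; split; lra.
have mf := measurable_falpha ha; have f01 := falpha_itv ha.
apply/andP; split.
  exact: (close_freq_le_corr mf f01 hl mE tE nuE E01 Ekap).
exact: (corr_le_close_freq mf f01 hl mE tE nuE E01 Ekap).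
Qed.

Lemma iter_falpha_k0 (k n : nat) : iter n (falpha_k a k.+1) 0 = kap a k.+1 n.
Proof.
by elim: n => [|n IHn]; rewrite ?kap0//= IHn falpha_k_kap.
Qed.

Lemma orbit_falpha_k (k : nat) :
  orbit_of (falpha_k a k.+1) 0 = kap a k.+1 @` `I_(2 ^ k.+1).
Proof.
apply/seteqP; split => _ [n _ <-]; last by exists n; rewrite ?iter_falpha_k0.
exists (n %% 2 ^ k.+1)%N; first by rewrite /= ltn_mod expn_gt0.
by rewrite kap_mod iter_falpha_k0.
Qed.

(** By [kap_inj] the orbit has exactly [2 ^ k.+1] points, so [mnormalize] divides the counting
    measure by this number. *)
Lemma mu_alpha_k_point (k : nat) (n : 'I_(2 ^ k.+1)) :
  mu_alpha_k a k.+1 [set kap a k.+1 n] = ((2 ^+ k.+1)^-1)%:E.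
Proof.
have finO : finite_set (orbit_of (falpha_k a k.+1) 0).
  rewrite orbit_falpha_k; apply: finite_image; exact: finite_II.
have cardO : counting (orbit_of (falpha_k a k.+1) 0 : set (measurableTypeR R))
    = (2 ^+ k.+1)%:E :> \bar R.
  rewrite /counting asboolT// (card_fset_set (n := (2 ^ k.+1)%N)) ?natrX//.
  rewrite orbit_falpha_k; apply: inj_card_eq => m m'; rewrite !inE /= => mk mk' mm'.
  have := @kap_inj k.+1 (Ordinal mk) (Ordinal mk').
  by rewrite /= mm' subrr normr0 => /(_ (ltW (expa_gt0 ha _)))[].
have pow_gt0 : (0 : R) < 2 ^+ k.+1 by rewrite exprn_gt0.
have : orbit_of (falpha_k a k.+1) 0 (kap a k.+1 n).
  by rewrite orbit_falpha_k; exists n => //=; exact: ltn_ord.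
move: (kap a k.+1 n) => x xO.
rewrite /mu_alpha_k /orbit_measure /= (@mnormalizeE _ _ _ _ _ (2 ^+ k.+1))//; last first.
  by rewrite /= /mrestr setTI.
have cx : counting (([set x] : set (measurableTypeR R)) `&`
    orbit_of (falpha_k a k.+1) 0) = 1%E :> \bar R.
  rewrite (_ : _ `&` _ = [set x]); last by apply/setIidPl => _ ->.
  by rewrite /counting asboolT ?fset_set1 ?finmap.cardfs1.
by rewrite -[RHS]mul1e -cx.
Qed.

(** Coding by the orbit points themselves has error [0], so the lower and upper bounds coincide. *)
Lemma corr_falpha_k (k : nat) (s : R) :
  corr (falpha_k a k.+1) (mu_alpha_k a k.+1) l s = close_freq a k.+1 l s.
Proof.
pose E (n : 'I_(2 ^ k.+1)) : set (measurableTypeR R) := [set kap a k.+1 n].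
have mE n : measurable (E n) by exact: measurable_set1.
have tE : trivIset setT E.
  move=> m n _ _ [x [/= -> mn]]; apply: kap_inj => //.
  by rewrite mn subrr normr0 ltW// expa_gt0.
have E01 n x : E n x -> 0 <= x <= 1.
  move=> ->; have := kap_ge0 ha k.+1 n; have := kap_le ha k.+1 n.
  by have := expa_gt0 ha k.+1 => *; apply/andP; split; lra.
have Ekap n x i : E n x ->
    `|iter i (falpha_k a k.+1) x - kap a k.+1 (n + i)| <= 0.
  move=> ->; suff -> : iter i (falpha_k a k.+1) (kap a k.+1 n) = kap a k.+1 (n + i).
    by rewrite subrr normr0.
  by elim: i => [|i IHi]; rewrite ?addn0// addnS iterS IHi falpha_k_kap.
have nuE := @mu_alpha_k_point k.
have mf := measurable_falpha_k ha k.+1; have f01 := falpha_k_itv ha k.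
apply/eqP; rewrite eq_le.
have := close_freq_le_corr mf f01 hl mE tE nuE E01 Ekap s.
have := corr_le_close_freq mf f01 hl mE tE nuE E01 Ekap s.
by rewrite mulr0 addr0 subr0 => -> ->.
Qed.

End codings.

(** * Continuity in the radius and limits in [k] *)

Section convergence.
Variables (R : realType) (a : R) (mu : probability (measurableTypeR R) R).
Hypotheses (ha : 0 < a < 1 / 2) (hmu : is_mu_alpha a mu).

Let a0 : 0 < a. Proof. by case/andP: ha. Qed.
Let a2 : a < 1 / 2. Proof. by case/andP: ha. Qed.

(** Continuity uniform in [k]: divided by the number of pairs, the error of [card_close_pairs] is
    [2 * L / 2 ^ j] for every [k >= j]. So [j] is chosen from [eta], and [d] is the gap at level
    [j]. *)
Lemma close_freq_window (l : option nat) (eta : R) : 0 < eta ->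
  exists d, 0 < d /\ \forall k \near \oo, forall s t, t - s < d ->
    close_freq a k l t <= close_freq a k l s + eta.
Proof.
move=> eta0; have [L card_L] := card_close_pairs ha l.
have [j Lj] : exists j, (2 * L)%:R * (2 ^+ j)^-1 <= eta.
  have : (fun j => (2 * L)%:R * (2^-1 : R) ^+ j) @ \oo --> (2 * L)%:R * (0 : R).
    apply: cvgMr; apply: cvg_expr; rewrite ger0_norm; lra.
  rewrite mulr0 => /cvgrPdist_le/(_ eta eta0)[j _ /(_ j (leqnn j))] /=.
  rewrite sub0r normrN exprVn => h; exists j; exact: le_trans (ler_norm _) h.
exists ((1 - 2 * a) * a ^+ j); split.
  by rewrite mulr_gt0 ?expa_gt0//; have := a2; lra.
exists j => // k /= jk s t st.
apply: le_trans (lerD (lexx _) Lj).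
have p0 (m : nat) : (0 : R) < 2 ^+ m by rewrite exprn_gt0.
rewrite /close_freq -ler_pdivlMr ?mulr_gt0 ?invr_gt0//.
have -> : (#|close_pairs a k l s|%:R * ((2 ^+ k)^-1 * (2 ^+ k)^-1) +
    (2 * L)%:R * (2 ^+ j)^-1) / ((2 ^+ k)^-1 * (2 ^+ k)^-1) =
    (#|close_pairs a k l s| + L * (2 ^ k * (2 * 2 ^ (k - j))))%:R :> R.
  rewrite natrD !natrM !natrX exprB// ?unitfE//.
  by field; rewrite !gt_eqF.
by rewrite ler_nat; exact: card_L.
Qed.

Lemma corr_falpha_continuous (l : option nat) (r : R) : lt_length 0 l ->
  corr (falpha a) mu l s @[s --> r] --> corr (falpha a) mu l r.
Proof.
move=> hl; apply/cvgrPdist_le => eta eta0.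
have [d [d0 win]] := close_freq_window l eta0.
(* With these margins the interval from [r - 2 * a ^+ k] to [s + 2 * a ^+ k], or with [r] and [s]
   exchanged, is shorter than [d / 4 + 4 * (d / 8) < d]; one fixed [k] serves all [s] near [r]. *)
have d4 : 0 < d / 4 by lra.
have d8 : 0 < d / 8 by lra.
near \oo => k.
have k0 : (0 < k)%N by near: k; exists 1%N.
have ak : a ^+ k < d / 8 by near: k; exact: (expa_near ha).
have wink s t : t - s < d -> close_freq a k l t <= close_freq a k l s + eta.
  by move: s t; near: k.
near=> s.
have : `|r - s| < d / 4 by near: s; exact: cvgr_dist_lt.
rewrite ltr_norml => /andP[rs1 rs2].
have /andP[r1 r2] := corr_falpha_bounds ha hl r hmu k0.
have /andP[s1 s2] := corr_falpha_bounds ha hl s hmu k0.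
have := wink (r - 2 * a ^+ k) (s + 2 * a ^+ k) ltac:(lra).
have := wink (s - 2 * a ^+ k) (r + 2 * a ^+ k) ltac:(lra).
by rewrite ler_norml => w1 w2; apply/andP; split; lra.
Unshelve. all: by end_near. Qed.

Lemma corr_falpha_k_cvg (l : option nat) (r : R) : lt_length 0 l ->
  corr (falpha_k a k) (mu_alpha_k a k) l r @[k --> \oo]
    --> corr (falpha a) mu l r.
Proof.
move=> hl; apply/cvgrPdist_le => eta eta0.
have [d [d0 win]] := close_freq_window l eta0.
(* The periodic system has exactly the frequency at [r], so only windows of length [2 * a ^+ k]
   occur. *)
have d2 : 0 < d / 2 by lra.
near=> k.
have k0 : (0 < k)%N by near: k; exists 1%N.
have ak : a ^+ k < d / 2 by near: k; exact: (expa_near ha).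
have wink s t : t - s < d -> close_freq a k l t <= close_freq a k l s + eta.
  by move: s t; near: k.
have /andP[r1 r2] := corr_falpha_bounds ha hl r hmu k0.
have -> : corr (falpha_k a k) (mu_alpha_k a k) l r = close_freq a k l r.
  by rewrite -(prednK k0); exact: corr_falpha_k.
have := wink (r - 2 * a ^+ k) r ltac:(lra).
have := wink r (r + 2 * a ^+ k) ltac:(lra).
by rewrite ler_norml => w1 w2; apply/andP; split; lra.
Unshelve. all: by end_near. Qed.

(** Once [2 * a ^+ k < r], a diagonal pair of words is close at the reduced radius. For [l = Some 1]
    this makes the denominator of [determinism] nonzero. *)
Lemma corr_falpha_gt0 (l : option nat) (r : R) : lt_length 0 l -> 0 < r ->
  0 < corr (falpha a) mu l r.
Proof.
move=> hl r0; have r2 : 0 < r / 2 by lra.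
have [k _ /(_ k.+1 (leqnSn k)) /= ak] := expa_near ha r2.
have /andP[+ _] := corr_falpha_bounds ha hl r hmu (ltn0Sn k).
apply: lt_le_trans; rewrite mulr_gt0 ?mulr_gt0 ?invr_gt0 ?exprn_gt0//.
rewrite ltr0n card_gt0; apply/set0Pn.
have i0 : (0 < 2 ^ k.+1)%N by rewrite expn_gt0.
exists (Ordinal i0, Ordinal i0); apply/in_close_pairs => i _.
by rewrite subrr normr0; lra.
Qed.

End convergence.

(** Map, measure and radius all vary along an arbitrary filter, so that one statement gives both
    continuity in the radius and the limit in [k]. *)
Lemma determinism_cvg (R : realType) (T : Type) (F : set_system T)
    (FF : Filter F) (g : T -> R -> R)
    (nu : T -> probability (measurableTypeR R) R) (s : T -> R)
    (g0 : R -> R) (nu0 : probability (measurableTypeR R) R) (r : R)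
    (l : option nat) :
  (forall m, lt_length 0 m ->
    corr (g t) (nu t) m (s t) @[t --> F] --> corr g0 nu0 m r) ->
  lt_length 0 l -> corr g0 nu0 (Some 1%N) r != 0 ->
  determinism (g t) (nu t) l (s t) @[t --> F] --> determinism g0 nu0 l r.
Proof.
move=> cF hl c1; case: l hl => [n|] hl; rewrite /determinism.
  apply: cvgM; last by apply: cvgV => //; exact: cF.
  by apply: cvgB; apply: cvgMr; exact: cF.
by apply: cvgM; [exact: cF|apply: cvgV => //; exact: cF].
Qed.

Unset Implicit Arguments.

Theorem theorem23 (R : realType) (a r : R)
    (mu : probability (measurableTypeR R) R) (l : option nat)
    (ha : 0 < a < 1 / 2) (hr : 0 < r <= 1)
    (hmu : is_mu_alpha a mu) (hl : lt_length 0 l) :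
  [/\ {for r, continuous (corr (falpha a) mu l)},
      {for r, continuous (determinism (falpha a) mu l)},
      corr (falpha_k a k) (mu_alpha_k a k) l r @[k --> \oo]
        --> corr (falpha a) mu l r
    & determinism (falpha_k a k) (mu_alpha_k a k) l r @[k --> \oo]
        --> determinism (falpha a) mu l r].
Proof.
have c1 : corr (falpha a) mu (Some 1%N) r != 0.
  by rewrite gt_eqF// corr_falpha_gt0//; case/andP: hr.
split.
- exact: corr_falpha_continuous.
- apply: determinism_cvg => // m hm; exact: corr_falpha_continuous.
- exact: corr_falpha_k_cvg.
- apply: determinism_cvg => // m hm; exact: corr_falpha_k_cvg.
Qed.
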